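(* Let $p$ be a prime and let $\mathbb{L}$ be a subfield of $\mathbb{Q}[\zeta_p]$. Then there exists a circulant digraph on $p$ vertices whose adjacency matrix represents $\mathbb{L}$.
   Context: $\zeta_p$ is a primitive $p$-th root of unity. A digraph is circulant if its adjacency matrix is a circulant matrix. A matrix $A$ with rational entries is said to represent a field extension $\mathbb{K}$ of $\mathbb{Q}$ if there exists an irreducible polynomial $q(x)\in\mathbb{Q}[x]$ dividing the minimal polynomial of $A$ such that $\mathbb{K}\cong \mathbb{Q}[A]/\langle q(A)\rangle$, where $\mathbb{Q}[A]$ is the algebra of polynomials in $A$ and $\langle q(A)\rangle$ is the ideal it generates. *)

(* Defs.v *)
From HB Require Import structures.
From mathcomp Require Import all_boot all_order all_algebra all_field.
From mathcomp Require Import boolp.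

Set Implicit Arguments.
Unset Strict Implicit.
Unset Printing Implicit Defensive.

Import GRing.Theory.
Local Open Scope ring_scope.

(* Principal ideals.  Ring quotients in ring_quotient.v are nontrivial rings,
   so the ideal has to come with a proof that it is proper. *)
Section PrincipalIdeal.
Variables (R : comNzRingType) (a : R) (nua : ~ exists c, c * a = 1).

Definition principal_ideal of ~ (exists c : R, c * a = 1) : {pred R} :=
  fun x => `[< exists c, x = c * a >].

Local Notation I := (principal_ideal nua).

Lemma principal_idealP x : reflect (exists c, x = c * a) (x \in I).
Proof. exact: asboolP. Qed.

Lemma principal_ideal_closed : idealr_closed I.
Proof.
split; first by apply/principal_idealP; exists 0; rewrite mul0r.
  by apply/principal_idealP => -[c c1]; apply: nua; exists c.
move=> b x y /principal_idealP[c ->] /principal_idealP[d ->].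
by apply/principal_idealP; exists (b * c + d); rewrite mulrDl mulrA.
Qed.

HB.instance Definition _ :=
  isIdealr.Build R (principal_ideal nua) principal_ideal_closed.

End PrincipalIdeal.

(* mxalg A is the algebra Q[A], a commutative subring of the matrix ring, and
   mxalg_quot is Q[A] / <q(A)>, with <q(A)> the ideal of Q[A] generated by q(A). *)
Section MatrixAlgebra.
Variables (n : nat) (A : 'M[rat]_n.+1).

Definition polymx : {pred 'M[rat]_n.+1} :=
  fun B => `[< exists r : {poly rat}, B = horner_mx A r >].

Lemma polymxP B : reflect (exists r, B = horner_mx A r) (B \in polymx).
Proof. exact: asboolP. Qed.

Lemma polymx_subring_closed : subring_closed polymx.
Proof.
split=> [|x y|x y].
- by apply/polymxP; exists 1; rewrite rmorph1.
- move=> /polymxP[r ->] /polymxP[s ->].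
  by apply/polymxP; exists (r - s); rewrite rmorphB.
- move=> /polymxP[r ->] /polymxP[s ->].
  by apply/polymxP; exists (r * s); rewrite rmorphM.
Qed.

HB.instance Definition _ :=
  GRing.isSubringClosed.Build _ polymx polymx_subring_closed.

Record mxalg := MxAlg { mxalg_val : 'M[rat]_n.+1; _ : mxalg_val \in polymx }.

HB.instance Definition _ := [isSub for mxalg_val].
HB.instance Definition _ := [Choice of mxalg by <:].
HB.instance Definition _ := [SubChoice_isSubNzRing of mxalg by <:].

Lemma mxalg_mulC : commutative (@GRing.mul mxalg).
Proof.
move=> x y; apply: val_inj; rewrite !rmorphM /=.
case: x y => [_ /= /polymxP[r ->]] [_ /= /polymxP[s ->]].
exact: comm_horner_mx2.
Qed.

HB.instance Definition _ :=
  GRing.PzRing_hasCommutativeMul.Build mxalg mxalg_mulC.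

Lemma horner_mx_polymx r : horner_mx A r \in polymx.
Proof. by apply/polymxP; exists r. Qed.

Definition mxalg_horner (r : {poly rat}) : mxalg := MxAlg (horner_mx_polymx r).

Variables (q : {poly rat}) (irr_q : irreducible_poly q).
Hypothesis q_dvd : q %| mxminpoly A.

Lemma mxalg_horner_nonunit : ~ exists c : mxalg, c * mxalg_horner q = 1.
Proof.
case=> c /(congr1 val); rewrite rmorphM rmorph1 /= => c1.
have /polymxP[r cE] := valP c.
have : horner_mx A (r * q - 1) = 0.
  by rewrite rmorphB rmorph1 rmorphM /= -cE c1 subrr.
move/mxminpoly_min/(dvdp_trans q_dvd).
rewrite dvdp_addr ?dvdp_mulIr // dvdpNr dvdp1 => /eqP sq1.
by case: irr_q; rewrite sq1.
Qed.

Definition mxalg_quot : comNzRingType :=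
  {ideal_quot (principal_ideal mxalg_horner_nonunit)}.

End MatrixAlgebra.

(* Only matrices of size m.+1 carry a nontrivial ring structure.  The 0 x 0
   matrix has minimal polynomial 1, which no irreducible polynomial divides. *)
Definition represents (n : nat) : 'M[rat]_n -> fieldExtType rat -> Prop :=
  match n with
  | 0 => fun _ _ => False
  | m.+1 => fun A K =>
      exists (q : {poly rat}) (irr_q : irreducible_poly q)
             (q_dvd : q %| mxminpoly A)
             (f : {rmorphism K -> mxalg_quot irr_q q_dvd}), bijective f
  end.

(* Each row is the previous one shifted cyclically one step to the right:
   ordS is the cyclic successor i |-> i + 1 mod n on 'I_n. *)
Definition circulant_mx (R : Type) (n : nat) (A : 'M[R]_n) : Prop :=
  forall i j, A (ordS i) (ordS j) = A i j.

(* Digraphs have no loops and no multiple arcs: an arc relation on the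
   vertices, required to be irreflexive. *)
Record digraph (n : nat) := Digraph {
  arc :> rel 'I_n;
  arc_irr : irreflexive arc
}.

Definition adjacency_mx (n : nat) (D : digraph n) : 'M[rat]_n :=
  \matrix_(i, j) (D i j)%:R.

Definition circulant_digraph (n : nat) (D : digraph n) : Prop :=
  circulant_mx (adjacency_mx D).

(* Main.v *)
Require Import Defs.
From HB Require Import structures.
From mathcomp Require Import all_boot all_order all_algebra all_field.
From mathcomp Require Import boolp.

Set Implicit Arguments.
Unset Strict Implicit.
Unset Printing Implicit Defensive.

Import GRing.Theory Num.Theory.
Local Open Scope ring_scope.

(** Over L, the minimal polynomial of z is the product of the 'X - z ^+ h for h
    in some set H of exponents 0 < h < p.  Its second coefficient is, up to sign,
    the period x = \sum_(h in H) z ^+ h, so Q(x) is contained in L.  Conversely,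
    if z ^+ k is a root of the minimal polynomial of z over Q(x), it is a root of
    \sum_(h in H) 'X^h - x, so multiplication by k leaves the period unchanged;
    as z, ..., z ^+ (p - 1) are linearly independent over Q and 1 is in H, this
    forces k to be in H.  Hence z has the same degree over Q(x) as over L, and
    Q(x) = L.  The circulant digraph with connection set H has x as an
    eigenvalue, with eigenvector (z ^+ i)_i, so the minimal polynomial q of x
    divides that of the adjacency matrix A, and Q[A] / <q(A)> is Q(x). *)

Lemma size_geometric_poly (R : nzRingType) n :
  size (\sum_(i < n) 'X^i : {poly R}) = n.
Proof.
have -> : \sum_(i < n) 'X^i = \poly_(i < n) (1 : R).
  by rewrite poly_def; apply: eq_bigr => i _; rewrite scale1r.
case: n => [|n]; first by rewrite poly_def big_ord0 size_poly0.
by rewrite size_poly_eq ?oner_eq0.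
Qed.

Lemma map_geometric_poly (R S : nzRingType) (f : {rmorphism R -> S}) n :
  map_poly f (\sum_(i < n) 'X^i) = \sum_(i < n) 'X^i.
Proof. by rewrite rmorph_sum; apply: eq_bigr => i _; rewrite /= map_polyXn. Qed.

Section PrimeCyclotomic.
Variables (p : nat) (p_prime : prime p).

Lemma geometric_poly_prod (R : fieldType) (z : R) :
    p.-primitive_root z ->
  \sum_(i < p) 'X^i = \prod_(1 <= i < p) ('X - (z ^+ i)%:P).
Proof.
move=> z_prim; have := factor_Xn_sub_1 z_prim.
rewrite big_ltn ?prime_gt0 // expr0 subrX1 => /mulfI-> //.
by rewrite polyXsubC_eq0.
Qed.

Lemma root_geometric_poly (R : fieldType) (z : R) :
  p.-primitive_root z -> root (\sum_(i < p) 'X^i) z.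
Proof.
move=> z_prim; rewrite (geometric_poly_prod z_prim).
by rewrite big_ltn ?prime_gt1 // rootM root_XsubC expr1 eqxx.
Qed.

Lemma geometric_poly_neq0 (R : nzRingType) :
  \sum_(i < p) 'X^i != 0 :> {poly R}.
Proof. by rewrite -size_poly_gt0 size_geometric_poly prime_gt0. Qed.

(** The minimal polynomial over Q of a primitive [p]-th root of unity [w] in [algC] is cyclotomic of
    degree [p - 1], so no nonzero rational polynomial vanishing at [w] has size below [p]. *)
Lemma irreducible_geometric_poly :
  irreducible_poly (\sum_(i < p) 'X^i : {poly rat}).
Proof.
have [w w_prim] := C_prim_root_exists (prime_gt0 p_prime).
have [q [Dq mon_q] dv_q] := minCpolyP w.
have Phi_w : root (map_poly (@ratr algC) (\sum_(i < p) 'X^i)) w.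
  by rewrite map_geometric_poly root_geometric_poly.
apply/(subfx_irreducibleP Phi_w); first exact: geometric_poly_neq0.
move=> r r_w r_neq0; rewrite size_geometric_poly.
have <- : size q = p.
  rewrite -(size_map_poly (@ratr algC)) -Dq (minCpoly_cyclotomic w_prim).
  by rewrite size_cyclotomic totient_prime // prednK ?prime_gt0.
by apply: dvdp_leq => //; rewrite -dv_q.
Qed.

Variables (F : fieldExtType rat) (z : F) (z_prim : p.-primitive_root z).

(** Linear independence of z, ..., z ^+ (p - 1) over Q: dividing [r] by 'X leaves a polynomial that
    still vanishes at [z], of size less than [p]. *)
Lemma prim_root_powers_free (r : {poly rat}) :
  (size r <= p)%N -> r`_0 = 0 -> root (map_poly (in_alg F) r) z -> r = 0.
Proof.
move=> sr r0 rz; have /factor_theorem[t Dr] : root r 0.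
  by rewrite rootE horner_coef0 r0.
rewrite subr0 in Dr; have [t0 | t_neq0] := eqVneq t 0.
  by rewrite Dr t0 mul0r.
have Phi_z : root (map_poly (in_alg F) (\sum_(i < p) 'X^i)) z.
  by rewrite map_geometric_poly root_geometric_poly.
have tz : root (map_poly (in_alg F) t) z.
  move: rz; rewrite Dr rmorphM rootM /= map_polyX rootX.
  by rewrite (prim_root_eq0 z_prim) eqn0Ngt prime_gt0 ?orbF.
have := (subfx_irreducibleP Phi_z (geometric_poly_neq0 _)).2
  irreducible_geometric_poly t tz t_neq0.
by rewrite size_geometric_poly leqNgt -(size_mulX t_neq0) -Dr sr.
Qed.

(** The minimal polynomial divides the geometric polynomial, which splits over [F] into distinct
    linear factors; [a] selects the exponents of those that remain. *)
Lemma minPoly_prim_root (K : {subfield F}) :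
  {a : pred nat | minPoly K z = \prod_(1 <= i < p | a i) ('X - (z ^+ i)%:P)}.
Proof.
have /dvdp_prod_XsubC[m Dm] :
    minPoly K z %| \prod_(1 <= i < p) ('X - (z ^+ i)%:P).
  rewrite -geometric_poly_prod //; apply: minPoly_dvdp.
    by apply: rpred_sum => i _; rewrite rpredX ?polyOverX.
  exact: root_geometric_poly.
exists [in mask m (index_iota 1 p)]; rewrite -big_filter.
rewrite -(subseq_uniqP (iota_uniq _ _) (mask_subseq _ _)).
by apply/eqP; rewrite -eqp_monic ?monic_minPoly ?monic_prod_XsubC.
Qed.

Lemma prod_prim_root_filter (a : pred nat) :
  \prod_(1 <= i < p | a i) ('X - (z ^+ i)%:P) =
  \prod_(y <- [seq z ^+ i | i <- index_iota 1 p & a i]) ('X - y%:P).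
Proof. by rewrite big_map big_filter. Qed.

Lemma root_prod_prim_root (a : pred nat) k :
    (0 < k < p)%N ->
  root (\prod_(1 <= i < p | a i) ('X - (z ^+ i)%:P)) (z ^+ k) = a k.
Proof.
move=> k_range; rewrite prod_prim_root_filter root_prod_XsubC.
apply/mapP/idP => [[i]|ak]; last first.
  by exists k; rewrite // mem_filter ak mem_index_iota.
rewrite mem_filter mem_index_iota => /andP[ai /andP[_ i_lt_p]] /eqP.
case/andP: k_range => _ k_lt_p.
by rewrite (eq_prim_root_expr z_prim) !modn_small // => /eqP->.
Qed.

(* The two sides are sums of powers z ^+ i with 0 < i < p and nonnegative integer
   multiplicities; the term h = 1 on the left puts z ^+ k in the right-hand sum. *)
Lemma period_stabiliser (a : pred nat) k :
    (0 < k < p)%N -> a 1%N ->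
    \sum_(1 <= h < p | a h) z ^+ (k * h) = \sum_(1 <= h < p | a h) z ^+ h ->
  a k.
Proof.
move=> /andP[k_gt0 k_lt_p] a1 eq_z; apply: contraT => nak.
(* Reducing exponents modulo [p] keeps the size at most [p]; none becomes 0, since [p] divides
   neither [k] nor [h]. *)
pose r : {poly rat} := \sum_(1 <= h < p | a h) ('X^(k * h %% p) - 'X^h).
have r0 : r = 0.
  apply: prim_root_powers_free.
  - rewrite /r big_seq_cond (leq_trans (size_sum _ _ _)) //.
    apply/bigmax_leqP_seq => h _ /andP[]; rewrite mem_index_iota.
    move=> /andP[_ h_lt_p] _; rewrite (leq_trans (size_polyD _ _)) //.
    by rewrite size_polyN !size_polyXn geq_max h_lt_p ltn_pmod ?prime_gt0.
  - rewrite coef_sum big_seq_cond big1 // => h /andP[].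
    rewrite mem_index_iota => /andP[h_gt0 h_lt_p] _.
    rewrite coefB !coefXn !(eq_sym 0%N) (gtn_eqF h_gt0) -/(dvdn p _).
    by rewrite Euclid_dvdM // !gtnNdvd ?subrr.
  - rewrite rootE rmorph_sum horner_sum.
    rewrite (eq_bigr (fun h => z ^+ (k * h) - z ^+ h)) ?sumrB ?eq_z ?subrr //.
    move=> h _; rewrite rmorphB /= !map_polyXn !hornerE.
    by rewrite (prim_expr_mod z_prim).
have /eqP := congr1 (fun t : {poly rat} => t`_k) r0.
rewrite coef0 coef_sum (eq_bigr (fun h => (k == (k * h) %% p)%N%:R)).
  rewrite psumr_eq0 => [/allP/(_ 1%N)|h _]; last exact: ler0n.
  by rewrite mem_index_iota prime_gt1 // a1 muln1 modn_small // eqxx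
    => /(_ isT).
move=> h ah; rewrite coefB !coefXn (_ : (k == h) = false) ?subr0 //.
by apply: contraNF nak => /eqP->.
Qed.

Lemma subfield_period (L : {subfield F}) :
    (L <= <<1; z>>)%VS ->
  exists a : pred nat, (<<1; \sum_(1 <= i < p | a i) z ^+ i>> = L)%VS.
Proof.
move=> L_sub; have [a Da] := minPoly_prim_root L.
exists a; set x := \sum_(_ <= _ < _ | _) _.
have a1 : a 1%N.
  by rewrite -root_prod_prim_root ?prime_gt1 // -Da expr1 root_minPoly.
have xL : x \in L.
  pose s := [seq z ^+ i | i <- index_iota 1 p & a i].
  have s_neq0 : size s != 0%N.
    rewrite size_map size_filter -lt0n -has_count; apply/hasP; exists 1%N => //.
    by rewrite mem_index_iota prime_gt1.
  have /polyOverP/(_ (size s).-1) := minPolyOver L z.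
  rewrite Da prod_prim_root_filter coefPn_prod_XsubC //.
  by rewrite rpredN big_map big_filter.
pose K : {subfield F} := <<1; x>>%AS.
have KL : (K <= L)%VS by apply/FadjoinP; rewrite sub1v.
have [b Db] := minPoly_prim_root K.
have ba k : (0 < k < p)%N -> b k -> a k.
  move=> k_range bk; apply: period_stabiliser => //.
  have : minPoly K z %| \sum_(1 <= h < p | a h) 'X^h - x%:P.
    apply: minPoly_dvdp.
      rewrite rpredB ?polyOverC ?memv_adjoin //.
      by apply: rpred_sum => i _; rewrite rpredX ?polyOverX.
    rewrite rootE hornerD horner_sum hornerN hornerC subr_eq0; apply/eqP.
    by apply: eq_bigr => h _; rewrite hornerXn.
  case/dvdpP=> u /(congr1 (fun t => t.[z ^+ k])) /=; rewrite hornerM.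
  have /rootP -> : root (minPoly K z) (z ^+ k).
    by rewrite Db root_prod_prim_root.
  rewrite mulr0 hornerD horner_sum hornerN hornerC => /subr0_eq.
  rewrite -/x => <-.
  by apply: eq_bigr => h _; rewrite hornerXn exprM.
have degKL : (adjoin_degree K z <= adjoin_degree L z)%N.
  rewrite -ltnS -!size_minPoly Da Db !prod_prim_root_filter !size_prod_XsubC.
  rewrite ltnS !size_map uniq_leq_size ?filter_uniq ?iota_uniq //.
  move=> i; rewrite !mem_filter mem_index_iota => /andP[bi i_range].
  by rewrite i_range (ba i).
apply/eqP; rewrite eqEdim KL /=.
(* Adjoining [z] to [K] or to [L] gives the same field, so by the tower law the bound on degrees
   over [K] and [L] becomes dim L <= dim K. *)
have eqz (E : {subfield F}) : (E <= <<1; z>>)%VS -> (<<E; z>> = <<1; z>>)%VS.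
  move=> E_sub; apply/eqP; rewrite eqEsubv; apply/andP; split.
    by apply/FadjoinP; rewrite memv_adjoin.
  by apply/FadjoinP; rewrite sub1v memv_adjoin.
have := dim_Fadjoin K z; rewrite eqz ?(subv_trans KL) //.
rewrite -(eqz L) // dim_Fadjoin => eq_dim.
rewrite -(leq_pmul2l (ltn0Sn _ : 0 < adjoin_degree L z)%N).
by rewrite eq_dim leq_mul2r degKL orbT.
Qed.

End PrimeCyclotomic.

(** The isomorphism sends r(x) to the class of r(A), for rational polynomials r. *)
Lemma eigenvalue_represents n (A : 'M[rat]_n) (F : fieldExtType rat) (x : F)
    (L : {subfield F}) :
    (0 < n)%N -> eigenvalue (map_mx (in_alg F) A) x -> <<1; x>>%VS = L ->
  represents A (subvs_of L).
Proof.
case: n A => // n A _ x_eigen DL.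
have /polyOver1P[q Dq] := minPolyOver 1 x.
have dvd_q (r : {poly rat}) : (q %| r) = ((map_poly (in_alg F) r).[x] == 0).
  rewrite -(dvdp_map (in_alg F)) -Dq -rootE; apply/idP/idP => [|rx].
    rewrite root_factor_theorem; apply: dvdp_trans.
    by rewrite -root_factor_theorem root_minPoly.
  by apply: minPoly_dvdp => //; apply/polyOver1P; exists r.
have irr_q : irreducible_poly q.
  have qx : root (map_poly (in_alg F) q) x by rewrite -Dq root_minPoly.
  have q_neq0 : q != 0.
    by rewrite -(map_poly_eq0 (in_alg F)) -Dq monic_neq0 ?monic_minPoly.
  apply/(subfx_irreducibleP qx q_neq0) => r rx r_neq0.
  by apply: dvdp_leq; rewrite ?dvd_q.
have q_dvd : q %| mxminpoly A.
  by rewrite dvd_q -mxminpoly_map -rootE -eigenvalue_root_min.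
exists q, irr_q, q_dvd.
pose Q := mxalg_quot irr_q q_dvd.
pose phi (r : {poly rat}) : Q := \pi_Q%qT (mxalg_horner A r).
have mxhB r s : mxalg_horner A (r - s) = mxalg_horner A r - mxalg_horner A s.
  by apply: val_inj; rewrite rmorphB /= rmorphB.
have mxhM r s : mxalg_horner A (r * s) = mxalg_horner A r * mxalg_horner A s.
  by apply: val_inj; rewrite rmorphM /= rmorphM.
have mxh1 : mxalg_horner A 1 = 1 by apply: val_inj; rewrite rmorph1 /= rmorph1.
(* If r(A) - s(A) = t(A) q(A), then the minimal polynomial of [A], and hence [q], divides r - s - t
   q; so [q] divides r - s. *)
have phi_eq r s : (phi r == phi s) =
    ((map_poly (in_alg F) r).[x] == (map_poly (in_alg F) s).[x]).
  rewrite -[in RHS]subr_eq0 -hornerN -hornerD -rmorphB -dvd_q.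
  rewrite /phi -Quotient.idealrBE -mxhB.
  apply/principal_idealP/idP => [[c]|/dvdpP[t ->]]; last first.
    by exists (mxalg_horner A t); apply: val_inj; rewrite /= rmorphM.
  have /polymxP[t Dc] := valP c; move/(congr1 val).
  rewrite rmorphM /= Dc -rmorphM => /eqP.
  rewrite -subr_eq0 -rmorphB -dvd_mxminpoly => /(dvdp_trans q_dvd).
  by rewrite dvdp_addl // dvdpNr dvdp_mull.
have phiB r s : phi (r - s) = phi r - phi s by rewrite /phi mxhB rmorphB.
have phiM r s : phi (r * s) = phi r * phi s by rewrite /phi mxhM rmorphM.
have phi1 : phi 1 = 1 by rewrite /phi mxh1 rmorph1.
(* By [phi_eq], the class [phi (rp y)] does not depend on which polynomial is chosen for [y]. *)
have /choice[rp rpE] (y : subvs_of L) :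
    exists r : {poly rat}, vsval y = (map_poly (in_alg F) r).[x].
  by apply/Fadjoin1_polyP; rewrite DL subvsP.
pose f y := phi (rp y).
have fB : zmod_morphism f.
  move=> y t; rewrite /f -phiB; apply/eqP.
  by rewrite phi_eq rmorphB hornerD hornerN -!rpE.
have fM : monoid_morphism f.
  split=> [|y t].
    by apply/eqP; rewrite -phi1 phi_eq -rpE !rmorph1 hornerC.
  by apply/eqP; rewrite -phiM phi_eq rmorphM hornerM -!rpE.
pose f_zmod := GRing.isZmodMorphism.Build _ _ f fB.
pose f_monoid := GRing.isMonoidMorphism.Build _ _ f fM.
pose fR : {rmorphism subvs_of L -> Q} := HB.pack f f_zmod f_monoid.
exists fR.
have f_surj (y : Q) : exists t, f t == y.
  elim/quotW: y => c; have /polymxP[r Dc] := valP c.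
  have -> : c = mxalg_horner A r by apply: val_inj.
  have rx : (map_poly (in_alg F) r).[x] \in L.
    by rewrite -DL; apply/Fadjoin1_polyP; exists r.
  by exists (vsproj L (map_poly (in_alg F) r).[x]); rewrite phi_eq -rpE vsprojK.
exists (fun y => xchoose (f_surj y)) => [t|y];
  last exact/eqP/(xchooseP (f_surj y)).
apply: (fmorph_inj fR); exact/eqP/(xchooseP (f_surj _)).
Qed.

(* F is any finite extension of Q containing a primitive p-th root of unity z;
   <<1; z>> is Q[z] inside F. *)
Theorem theorem2p13 (p : nat) (p_prime : prime p)
    (F : fieldExtType rat) (z : F) (z_prim : p.-primitive_root z)
    (L : {subfield F}) (L_sub : (L <= <<1; z>>)%VS) :
  exists D : digraph p,
    circulant_digraph D /\ represents (adjacency_mx D) (subvs_of L).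
Proof.
have [a DL] := subfield_period p_prime z_prim L_sub.
have p_gt0 := prime_gt0 p_prime.
(* This is i - j modulo [p]. It vanishes only for i = j, so requiring it to be positive in [e]
   excludes exactly the loops. *)
pose k (i j : 'I_p) := ((i + (p - j)) %% p)%N.
pose e : rel 'I_p := fun i j => a (k i j) && (0 < k i j)%N.
have e_irr : irreflexive e.
  by move=> i; rewrite /e /k subnKC ?modnn ?andbF // ltnW.
exists (Digraph e_irr); split.
  move=> i j; rewrite !mxE /= /e (_ : k (ordS i) (ordS j) = k i j) //.
  apply/eqP; rewrite /k -(eqn_modDr (ordS j)) -addnA subnK ?modnDr ?modn_mod.
    rewrite /= modnDmr addnS -addnA subnK ?(ltnW (ltn_ord j)) //.
    by rewrite -addSn modnDr.
  exact/ltnW/ltn_ord.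
apply: eigenvalue_represents DL => //; apply/eigenvalueP.
exists (\row_j z ^+ j); last first.
  apply/eqP => /rowP/(_ (Ordinal p_gt0))/eqP.
  by rewrite !mxE expr0 oner_eq0.
apply/rowP => j; rewrite !mxE (big_nat_widenl _ 0) // big_mkord mulr_suml.
(* Substituting i - j for the summation index of the period turns each term times z ^+ j into z ^+
   i, weighted by the arc from i to j. *)
pose h (i : 'I_p) : 'I_p := Ordinal (ltn_pmod (i + (p - j)) p_gt0).
have h_inj : injective h.
  move=> i1 i2 /(congr1 val)/eqP /=; rewrite eqn_modDr !modn_small //.
  by move/eqP/val_inj.
rewrite [RHS](reindex_inj h_inj) [RHS]big_mkcond; apply: eq_bigr => i _.
rewrite !mxE /= -/(k i j) -/(e i j).
case: (e i j); rewrite ?scale0r ?mulr0 // scale1r mulr1 -exprD.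
rewrite -(prim_expr_mod z_prim (_ + _)) modnDml -addnA subnK ?(ltnW (ltn_ord j)) //.
by rewrite modnDr (prim_expr_mod z_prim).
Qed.
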